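(* Let $I\subset[0,\infty)$ be an interval and let $f:I\to\mathbb{R}$ be a differentiable function on $I^{\circ}$, the interior of $I$, such that $f'\in L[a,b]$, where $a,b\in I$ with $a<b$. If $|f'|$ is $s$-convex on $[a,b]$ for some fixed $s\in(0,1]$ and $x\in[a,b]$, then for every $\alpha>0$, $$\left|\frac{(x-a)^{\alpha}f(a)+(b-x)^{\alpha}f(b)}{b-a}-\frac{\Gamma(\alpha+1)}{b-a}\left[J_{x^{-}}^{\alpha}f(a)+J_{x^{+}}^{\alpha}f(b)\right]\right|$$ $$\le\frac{\alpha}{(s+1)(\alpha+s+1)}\left[\frac{(x-a)^{\alpha+1}+(b-x)^{\alpha+1}}{b-a}\right]|f'(x)|$$ $$+\left[\frac{1}{s+1}-\frac{\Gamma(\alpha+1)\Gamma(s+1)}{\Gamma(\alpha+s+2)}\right]\left[\frac{(x-a)^{\alpha+1}|f'(a)|+(b-x)^{\alpha+1}|f'(b)|}{b-a}\right].$$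
   Context: $\Gamma(\alpha)=\int_0^\infty e^{-u}u^{\alpha-1}\,du$ is the Euler Gamma function. The Riemann-Liouville fractional integrals of order $\alpha>0$ are $J_{c^{+}}^{\alpha}f(y)=\frac{1}{\Gamma(\alpha)}\int_{c}^{y}(y-t)^{\alpha-1}f(t)\,dt$ for $y>c$ and $J_{d^{-}}^{\alpha}f(y)=\frac{1}{\Gamma(\alpha)}\int_{y}^{d}(t-y)^{\alpha-1}f(t)\,dt$ for $y<d$. Thus $$J_{x^{-}}^{\alpha}f(a)=\frac{1}{\Gamma(\alpha)}\int_{a}^{x}(t-a)^{\alpha-1}f(t)\,dt,\qquad J_{x^{+}}^{\alpha}f(b)=\frac{1}{\Gamma(\alpha)}\int_{x}^{b}(b-t)^{\alpha-1}f(t)\,dt,$$ where the first is $0$ if $x=a$ and the second is $0$ if $x=b$. $f'\in L[a,b]$ means that $f'$ exists on $[a,b]$ (as a one-sided derivative at $a$ or $b$ if that point is an endpoint of $I$) and is Lebesgue integrable on $[a,b]$. A function $g:[a,b]\to\mathbb{R}$, with $[a,b]\subset[0,\infty)$, is $s$-convex (in the second sense) on $[a,b]$ if $g(\lambda u+\mu v)\le\lambda^{s}g(u)+\mu^{s}g(v)$ for all $u,v\in[a,b]$ and all $\lambda,\mu\ge0$ with $\lambda+\mu=1$. *)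

(* Defs.v *)
From HB Require Import structures.
From mathcomp Require Export all_boot all_order all_algebra.
From mathcomp Require Export all_classical all_reals all_analysis.

Set Implicit Arguments.
Unset Strict Implicit.
Unset Printing Implicit Defensive.
Export Order.TTheory GRing.Theory Num.Theory.
Export numFieldNormedType.Exports.

Global Open Scope classical_set_scope.
Global Open Scope ring_scope.

Section Definitions.
Context {R : realType}.
Implicit Types (I A : set R) (f g : R -> R) (s alpha c d y : R).

Local Notation mu := (@lebesgue_measure R).

(* The difference quotient only samples f on I, so that on an interval this is
   the usual two-sided derivative at interior points of I and the one-sided
   derivative at an endpoint of I; values of f outside I play no role. *)
Definition derivable_in I f y : Prop :=
  cvg ((z - y)^-1 * (f z - f y) @[z --> within I y^']).

Definition derive_in I f y : R :=
  lim ((z - y)^-1 * (f z - f y) @[z --> within I y^']).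

(* [f' \in L[a, b]], f being defined on I and [a, b] included in I. *)
Definition derive_in_L1 I f (a b : R) : Prop :=
  (forall y, a <= y <= b -> derivable_in I f y) /\
  mu.-integrable `[a, b] (EFin \o derive_in I f).

(* In the second sense; for 0 < s the convention 0 `^ s = 0 is the usual one. *)
Definition s_convex_on s A g : Prop :=
  forall u v, A u -> A v ->
  forall l m : R, 0 <= l -> 0 <= m -> l + m = 1 ->
    g (l * u + m * v) <= l `^ s * g u + m `^ s * g v.

(* Here and below, open intervals avoid evaluating the kernel at its
   singularity when alpha < 1. *)
Definition Gamma alpha : R :=
  \int[mu]_(u in `]0, +oo[) (expR (- u) * u `^ (alpha - 1)).

(* J_{c+}^alpha f (y), equal to 0 when y = c. *)
Definition RL_right c alpha f y : R :=
  (Gamma alpha)^-1 * \int[mu]_(t in `]c, y[) ((y - t) `^ (alpha - 1) * f t).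

(* J_{d-}^alpha f (y), equal to 0 when y = d. *)
Definition RL_left d alpha f y : R :=
  (Gamma alpha)^-1 * \int[mu]_(t in `]y, d[) ((t - y) `^ (alpha - 1) * f t).

End Definitions.

(* Main.v *)
From mathcomp Require Import ring lra.
Require Import Defs.
From mathcomp Require Import measurable_realfun.

Set Implicit Arguments.
Unset Strict Implicit.
Unset Printing Implicit Defensive.

(** On the left piece, substitute [t = a + (x - a) u]. With
    [h u = f (a + (x - a) u)] the quantity to bound becomes
    [(x - a) ^ alpha * (h 0 - alpha * \int_0^1 u ^ (alpha - 1) h u)], that is,
    since [alpha * \int_0^1 u ^ (alpha - 1) = 1], a weighted mean of
    [h 0 - h u]. The right piece has the same form with [b] in place of [a],
    the slope [x - b] of the substitution being negative; so both are instances
    of one estimate on the unit interval ([segment_mean_le]).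

    There, s-convexity of [|f'|] at the point [(1 - u) a + u x] reads
    [|h' u| <= D u ^ s + C (1 - u) ^ s], where [D] and [C] are [x - a] times
    [|f' x|] and [|f' a|]. The right-hand side is the derivative of the
    explicit function [growth], so a monotonicity argument gives
    [|h u - h 0| <= growth u] without integrating [f'] ([norm_sub_le_growth]).
    It remains to integrate [u ^ (alpha - 1) * growth u]
    ([weighted_mean_growth]): the first term of [growth] gives the coefficient
    of [|f' x|], and the second one gives
    [(1 - alpha B (alpha, s + 2)) / (s + 1)], where [B] is the Beta integral.

    The coefficient of [|f' a|] in the statement is then obtained from
    [B (p, q) = Gamma p * Gamma q / Gamma (p + q)]. That identity is proved by
    writing [Gamma p * Gamma q] as a double integral of nonnegative functions,
    translating the inner variable and exchanging the order of integration
    ([Gamma_ereal_Beta_ereal]). It is established in the extended reals, where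
    it holds for all exponents; the case [q = 1] is the functional equation of
    Gamma, from which its finiteness at positive arguments follows
    ([Gamma_ereal_fin_num]). *)

(** * Affine change of variable *)

Section affine.
Context {R : realType}.
Local Notation mu := (@lebesgue_measure R).
Implicit Types (c k : R).

Lemma measurable_affine c k :
  measurable_fun [set: measurableTypeR R]
    ((fun t => c + k * t) : _ -> measurableTypeR R).
Proof. by apply: measurable_funD => //; apply: measurable_funM. Qed.

(** Lebesgue measure is characterized by its values on the intervals
    [`]a, b]], and the preimage of such an interval is again an interval, whose
    type of end points depends on the sign of [k]. *)
Lemma lebesgue_measure_affine c k (A : set R) : k != 0 -> measurable A ->
  (`|k|%:E * pushforward mu ((fun t => (c + k * t)%R) : _ -> measurableTypeR R) A
   = mu A)%E.
Proof.
move=> k0 mA.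
pose phi := ((fun t => c + k * t) : measurableTypeR R -> measurableTypeR R).
(* An abstract measure hides the measurability proof that the instance
   on pushforwards depends on. *)
have [nu nuE] : exists nu : {measure set (measurableTypeR R) -> \bar R},
    forall B, nu B = (`|k|%:E * mu (phi @^-1` B))%E.
  have mphi : measurable_fun setT phi := measurable_affine c k.
  by unshelve eexists (mscale (NngNum (normr_ge0 k)) (pushforward mu phi)).
rewrite -[LHS]nuE; apply/esym/lebesgue_measure_unique => //= _ [[a b]] _ <-.
rewrite nuE /=.
have [kgt|klt|/eqP] := ltgtP 0 k; last by rewrite eq_sym (negbTE k0).
- have -> : phi @^-1` `]a, b]%classic = `](a - c) / k, (b - c) / k]%classic.
    by apply/seteqP; split => t /=; rewrite !in_itv/= /phi ltr_pdivrMr// ler_pdivlMr//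
      ltrBlDl lerBrDl ![t * k]mulrC.
  rewrite [lebesgue_measure _]lebesgue_measure_itv [X in (_ * X)%E]lebesgue_measure_itv/=.
  rewrite !lte_fin ltr_pM2r ?invr_gt0// ltrD2r; case: ifPn => _; last by rewrite mule0.
  by rewrite -!EFinD -EFinM gtr0_norm//; congr EFin; field.
- have -> : phi @^-1` `]a, b]%classic = `[(b - c) / k, (a - c) / k[%classic.
    by apply/seteqP; split => t /=; rewrite !in_itv/= /phi ltr_ndivlMr// ler_ndivrMr//
      ltrBlDl lerBrDl ![t * k]mulrC andbC.
  rewrite [lebesgue_measure _]lebesgue_measure_itv [X in (_ * X)%E]lebesgue_measure_itv/=.
  rewrite !lte_fin ltr_nM2r ?invr_lt0// ltrD2r; case: ifPn => _; last by rewrite mule0.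
  by rewrite -!EFinD -EFinM ltr0_norm//; congr EFin; field.
Qed.

Lemma ge0_integral_affine c k (D : set (measurableTypeR R)) (f : R -> \bar R) : k != 0 ->
  measurable D -> measurable_fun D f -> (forall x, 0 <= f x)%E ->
  (\int[mu]_(t in D) f t =
   `|k|%:E * \int[mu]_(t in [set t | D (c + k * t)%R]) f (c + k * t)%R)%E.
Proof.
move=> k0 mD mf f0.
pose phi := ((fun t => c + k * t) : measurableTypeR R -> measurableTypeR R).
have mphi : measurable_fun setT phi by exact: measurable_affine.
have [nu nuE] : exists nu : {measure set (measurableTypeR R) -> \bar R},
    nu = pushforward mu phi :> (set _ -> _).
  by unshelve eexists (pushforward mu phi).
transitivity (\int[mscale (NngNum (normr_ge0 k)) nu]_(t in D) f t)%E.
  apply: eq_measure_integral => A mA _.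
  transitivity (`|k|%:E * nu A)%E; last by [].
  by rewrite nuE; exact/esym/lebesgue_measure_affine.
rewrite ge0_integral_mscale//; congr (_ * _)%E.
rewrite -(ge0_integral_pushforward mphi mu mD mf)//.
by apply: eq_measure_integral => // A mA _; rewrite nuE.
Qed.

Lemma ge0_integralT_affine c k (f : R -> \bar R) : k != 0 ->
  measurable_fun [set: R] f -> (forall x, 0 <= f x)%E ->
  (\int[mu]_t f t = `|k|%:E * \int[mu]_t f (c + k * t)%R)%E.
Proof. by move=> k0 mf f0; exact: (@ge0_integral_affine c k setT). Qed.

(** Integrability makes the integrals of the positive and negative parts finite,
    so that the nonnegative case applies to each of them. *)
Lemma Rintegral_affine c k (D : set (measurableTypeR R)) (f : R -> R) : k != 0 ->
  measurable D -> mu.-integrable D (EFin \o f) ->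
  \int[mu]_(t in D) f t =
  `|k| * \int[mu]_(t in [set t | D (c + k * t)%R]) f (c + k * t).
Proof.
move=> k0 mD intf.
have finE (g : R -> \bar R) : mu.-integrable D g -> (forall x, 0 <= g x)%E ->
    exists2 r, (\int[mu]_(t in D) g t = (`|k| * r)%:E)%E &
      (\int[mu]_(t in [set t | D (c + k * t)%R]) g (c + k * t)%R = r%:E)%E.
  move=> ig g0; have := integrable_fin_num mD ig.
  rewrite (@ge0_integral_affine c k)//; last exact: measurable_int ig.
  set J := (X in (_ * X)%E); have : (0 <= J)%E by exact: integral_ge0.
  case EJ : J => [r| |] J0 Jfin; [by exists r| |by []].
  by move: Jfin; rewrite gt0_muley ?lte_fin ?normr_gt0.
have [p Ep Jp] := finE _ (integrable_funepos mD intf) (funepos_ge0 _).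
have [m Em Jm] := finE _ (integrable_funeneg mD intf) (funeneg_ge0 _).
rewrite /Rintegral [in LHS]integralE [in RHS]integralE Ep Em.
rewrite [X in _ = _ * fine (X - _)%E](_ : _ = p%:E); last first.
  rewrite -Jp; apply: eq_integral => x _.
  by rewrite -[RHS]/(((EFin \o f)^\+ \o (fun t => c + k * t)%R)%E x) -funepos_comp.
rewrite [X in _ = _ * fine (_ - X)%E](_ : _ = m%:E) ?mulrBr//.
rewrite -Jm; apply: eq_integral => x _.
by rewrite -[RHS]/(((EFin \o f)^\- \o (fun t => c + k * t)%R)%E x) -funeneg_comp.
Qed.

End affine.

(** * Powers on the unit interval *)

Section powers.
Context {R : realType}.
Local Notation mu := (@lebesgue_measure R).
Implicit Types p q : R.

Lemma integral_powR_segment p (e : R) : 0 < p -> 0 < e -> e < 1 ->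
  (\int[mu]_(t in `[e, 1%R]) (t `^ (p - 1))%:E = (p^-1 - e `^ p / p)%:E)%E.
Proof.
move=> p0 e0 e1.
have gt0 t : t \in `[e, 1]%R -> 0 < t.
  by rewrite in_itv/= => /andP[et _]; exact: lt_le_trans et.
have cpow q (t : R) : t \in `[e, 1]%R -> {for t, continuous (@powR R ^~ q)}.
  move=> /gt0 t0; apply/differentiable_continuous/derivable1_diffP.
  by apply: derivable_powR; rewrite in_itv/= t0.
have cin (q : R) : {within `[e, 1], continuous (@powR R ^~ q)}.
  by apply: continuous_in_subspaceT => t; rewrite inE; exact: cpow.
rewrite (@continuous_FTC2 R (fun t => t `^ (p - 1)) (fun t => t `^ p / p) e 1)//.
- by rewrite powR1 mul1r.
- split.
  + move=> t te; apply: derivableM => //.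
    by apply: derivable_powR; rewrite in_itv/= (lt_trans e0)// (itvP te).
  + by apply: cvgM; [apply/cvg_at_right_filter/cpow; rewrite in_itv/= lexx ltW|exact: cvg_cst].
  + by apply: cvgM; [apply/cvg_at_left_filter/cpow; rewrite in_itv/= lexx ltW|exact: cvg_cst].
- move=> t te; have t0 : 0 < t by rewrite (lt_trans e0)// (itvP te).
  rewrite derive1Mr//; last by apply: derivable_powR; rewrite in_itv/= t0.
  rewrite powR_derive1 ?in_itv/= ?t0//.
  by field; rewrite gt_eqF.
Qed.

(** The integrand is unbounded near 0 when [p < 1]: the fundamental theorem of
    calculus applies on [`[e, 1]], and monotone convergence lets [e] tend to 0. *)
Lemma integral_powR01 p : 0 < p ->
  (\int[mu]_(t in `]0%R, 1%R[) (t `^ (p - 1))%:E = (p^-1)%:E)%E.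
Proof.
move=> p0.
have mpow (D : set R) : measurable_fun D (fun t : R => (t `^ (p - 1))%:E).
  by apply/measurable_EFinP; apply: measurable_funTS; exact: measurable_powR.
rewrite integral_itv_bndo_bndc; last exact: mpow.
pose e n : R := n.+2%:R^-1.
have e0 n : 0 < e n by rewrite invr_gt0.
have e1 n : e n < 1 by rewrite invf_lt1// ltr1n.
have <- : \bigcup_n `[e n, 1]%classic = `]0, 1]%classic.
  apply/seteqP; split => [t [n _]|t] /=; rewrite !in_itv/=.
    by move=> /andP[et ->]; rewrite (lt_le_trans (e0 n)).
  move=> /andP[t0 t1]; have [n nt] := ltr_add_invr t0.
  exists n => //=; rewrite in_itv/= t1 andbT; apply: ltW; apply: le_lt_trans nt.
  by rewrite add0r lef_pV2 ?posrE// ler_nat.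
have mE n : measurable (`[e n, 1]%classic : set (measurableTypeR R)) by [].
have ndE : nondecreasing_seq (fun n => `[e n, 1]%classic).
  move=> n m nm; apply/subsetPset/subset_itvr.
  by rewrite bnd_simp lef_pV2 ?posrE// ler_nat.
have ge0 n t : t \in `[e n, 1]%R -> (0 <= (t `^ (p - 1))%:E)%E.
  by move=> _; rewrite lee_fin powR_ge0.
have := ge0_nondecreasing_set_cvg_integral (mu := mu) ndE mE (fun=> mpow _) ge0.
under eq_fun do rewrite integral_powR_segment//.
move=> /cvg_lim <- //; apply/cvg_lim => //; apply: cvg_EFin; first exact: nearW.
rewrite -[X in _ --> X]subr0 -[X in _ --> _ - X](mul0r p^-1).
apply: cvgB; first exact: cvg_cst.
apply: cvgMr_tmp; have := powR_cvg0 p0.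
move/cvg_at_rightP; apply; split => //.
have := @cvg_harmonic R; rewrite -cvg_shiftS; exact.
Unshelve. all: by end_near. Qed.
End powers.

(** * The Beta-Gamma identity in the extended reals *)

Section beta_gamma.
Context {R : realType}.
Local Notation mu := (@lebesgue_measure R).
Implicit Types p q u w : R.

(** Extending the power by 0 lets all the integrals below range over the whole
    line, so that translations and dilations leave the domain unchanged and the
    constraint [0 < u < w] of a convolution is carried by the integrand. *)
Definition trunc_pow p : R -> R := (fun u => u `^ (p - 1)) \_ `]0, +oo[.

Lemma trunc_powE p u : trunc_pow p u = if 0 < u then u `^ (p - 1) else 0.
Proof. by rewrite /trunc_pow patchE mem_setE in_itv/= andbT. Qed.

Lemma trunc_pow_ge0 p u : 0 <= trunc_pow p u.
Proof. by rewrite trunc_powE; case: ifP => // _; exact: powR_ge0. Qed.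

Lemma measurable_trunc_pow p : measurable_fun [set: R] (trunc_pow p).
Proof.
apply/(measurable_restrictT (fun u => u `^ (p - 1))) => //.
by apply: measurable_funTS; exact: measurable_powR.
Qed.

Lemma trunc_powM p w u : 0 < w -> trunc_pow p (w * u) = w `^ (p - 1) * trunc_pow p u.
Proof.
move=> w0; rewrite !trunc_powE pmulr_rgt0//; case: ifPn => u0; last by rewrite mulr0.
by rewrite powRM ?ltW.
Qed.

Definition Beta_ereal p q : \bar R := (\int[mu]_u (trunc_pow p u * trunc_pow q (1 - u))%:E)%E.

Definition Gamma_ereal p : \bar R := (\int[mu]_u (expR (- u) * trunc_pow p u)%:E)%E.

Lemma Beta_ereal_ge0 p q : (0 <= Beta_ereal p q)%E.
Proof. by apply: integral_ge0 => u _; rewrite lee_fin mulr_ge0 ?trunc_pow_ge0. Qed.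

Lemma Gamma_ereal_ge0 p : (0 <= Gamma_ereal p)%E.
Proof.
by apply: integral_ge0 => u _; rewrite lee_fin mulr_ge0 ?expR_ge0 ?trunc_pow_ge0.
Qed.

Lemma measurable_trunc_pow_conv p q w :
  measurable_fun [set: R] (fun u => trunc_pow p u * trunc_pow q (w - u)).
Proof.
apply: measurable_funM; first exact: measurable_trunc_pow.
apply: measurableT_comp; first exact: measurable_trunc_pow.
exact: measurable_funB.
Qed.

Lemma measurable_Gamma_ereal p :
  measurable_fun [set: R] (fun u => (expR (- u) * trunc_pow p u)%:E).
Proof.
apply/measurable_EFinP; apply: measurable_funM; last exact: measurable_trunc_pow.
by apply: measurableT_comp => //; exact: measurable_expR.
Qed.

(** By homogeneity, the substitution [u -> w * u] reduces the convolution of two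
    truncated powers to its value at 1, which is the Beta integral. *)
Lemma integral_trunc_pow_conv p q w :
  (\int[mu]_u (trunc_pow p u * trunc_pow q (w - u))%:E =
   (trunc_pow (p + q) w)%:E * Beta_ereal p q)%E.
Proof.
have [w0|w0] := ltP 0 w; last first.
  rewrite [trunc_pow _ _]trunc_powE ltNge w0/= mul0e integral0_eq// => u _; rewrite !trunc_powE.
  case: ifPn => u0; last by rewrite mul0r.
  by rewrite ifF ?mulr0//; apply/negbTE; rewrite -leNgt; lra.
rewrite (@ge0_integralT_affine _ 0 w)//; last 3 first.
- by rewrite gt_eqF.
- by apply/measurable_EFinP; exact: measurable_trunc_pow_conv.
- by move=> u; rewrite lee_fin mulr_ge0 ?trunc_pow_ge0.
transitivity (`|w|%:E * \int[mu]_u ((w `^ (p - 1) * w `^ (q - 1))%:E *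
   (trunc_pow p u * trunc_pow q (1 - u))%:E))%E.
  congr (_ * _)%E; apply: eq_integral => u _; rewrite -EFinM add0r.
  rewrite (_ : w - w * u = w * (1 - u)); last by ring.
  by rewrite !trunc_powM//; congr EFin; ring.
rewrite ge0_integralZl_EFin//; last 3 first.
- by move=> u _; rewrite lee_fin mulr_ge0 ?trunc_pow_ge0.
- by apply/measurable_EFinP; exact: measurable_trunc_pow_conv.
- by rewrite mulr_ge0// powR_ge0.
rewrite muleA -EFinM gtr0_norm// trunc_powE w0; congr (_%:E * _)%E.
rewrite (_ : p + q - 1 = 1 + ((p - 1) + (q - 1))); last by ring.
by rewrite !powRD ?powRr1 ?(ltW w0) ?(gt_eqF w0) ?implybT.
Qed.

(** [Gamma_ereal p] is the integral of [e ^ (- u) * trunc_pow p u], and these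
    exponential weights multiply to [e ^ (- w)] in a convolution at [w]. The
    product of the two integrals is the integral of the convolution. *)
Lemma Gamma_ereal_Beta_ereal p q :
  (Gamma_ereal p * Gamma_ereal q = Beta_ereal p q * Gamma_ereal (p + q))%E.
Proof.
pose F u w : R := expR (- w) * (trunc_pow p u * trunc_pow q (w - u)).
have F0 u w : 0 <= F u w by rewrite !mulr_ge0 ?expR_ge0 ?trunc_pow_ge0.
rewrite {1}/Gamma_ereal -ge0_integralZr//; last 3 first.
- exact: measurable_Gamma_ereal.
- by move=> u _; rewrite lee_fin mulr_ge0 ?expR_ge0 ?trunc_pow_ge0.
- exact: Gamma_ereal_ge0.
transitivity (\int[mu]_u \int[mu]_w (F u w)%:E)%E.
  apply: eq_integral => u _; rewrite /Gamma_ereal -ge0_integralZl_EFin//; last 3 first.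
  - by move=> v _; rewrite lee_fin mulr_ge0 ?expR_ge0 ?trunc_pow_ge0.
  - exact: measurable_Gamma_ereal.
  - by rewrite mulr_ge0 ?expR_ge0 ?trunc_pow_ge0.
  (* With [v = w - u] the weight [e ^ (- u) * e ^ (- v)] becomes [e ^ (- w)]. *)
  rewrite [LHS](@ge0_integralT_affine _ (- u) 1)//; last 2 first.
  - apply: measurable_funeM; exact: measurable_Gamma_ereal.
  - by move=> v; rewrite -EFinM lee_fin !mulr_ge0 ?expR_ge0 ?trunc_pow_ge0.
  rewrite normr1 mul1e; apply: eq_integral => w _.
  rewrite -EFinM /F mul1r [- u + w]addrC; congr EFin.
  have -> : - w = - u + - (w - u) by ring.
  by rewrite expRD; ring.
have mF : measurable_fun [set: measurableTypeR R * measurableTypeR R]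
    (fun x => (F x.1 x.2)%:E).
  apply/measurable_EFinP; apply: measurable_funM.
    by apply: measurableT_comp => //; exact: measurableT_comp.
  apply: measurable_funM.
    by apply: measurableT_comp => //; exact: measurable_trunc_pow.
  apply: measurableT_comp; first exact: measurable_trunc_pow.
  exact: measurable_funB.
rewrite (fubini_tonelli (fun x : measurableTypeR R * measurableTypeR R =>
  (F x.1 x.2)%:E))//=; last by move=> x; rewrite lee_fin.
transitivity (\int[mu]_w (Beta_ereal p q * (expR (- w) * trunc_pow (p + q) w)%:E))%E.
  apply: eq_integral => w _; rewrite /F.
  under eq_integral do rewrite EFinM.
  rewrite ge0_integralZl_EFin ?expR_ge0//; last 2 first.
  - by move=> u _; rewrite lee_fin mulr_ge0 ?trunc_pow_ge0.
  - by apply/measurable_EFinP; exact: measurable_trunc_pow_conv.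
  by rewrite integral_trunc_pow_conv muleA -EFinM muleC.
rewrite ge0_integralZl ?Beta_ereal_ge0//; first exact: measurable_Gamma_ereal.
by move=> u _; rewrite lee_fin mulr_ge0 ?expR_ge0 ?trunc_pow_ge0.
Qed.
End beta_gamma.

(** * The real Gamma function *)

Section gamma.
Context {R : realType}.
Local Notation mu := (@lebesgue_measure R).
Implicit Types p q u w : R.

Lemma Gamma_ereal_itv p :
  Gamma_ereal p = (\int[mu]_(u in `]0%R, +oo[) (expR (- u) * u `^ (p - 1))%:E)%E.
Proof.
rewrite [RHS]integral_mkcond; apply: eq_integral => u _.
rewrite trunc_powE patchE mem_setE in_itv/= andbT.
by case: ifP => //; rewrite mulr0.
Qed.

Lemma Gamma_fine p : Gamma p = fine (Gamma_ereal p).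
Proof. by rewrite Gamma_ereal_itv. Qed.

Lemma Beta_ereal_itv p q :
  Beta_ereal p q = (\int[mu]_(u in `]0%R, 1%R[) (u `^ (p - 1) * (1 - u) `^ (q - 1))%:E)%E.
Proof.
rewrite [RHS]integral_mkcond; apply: eq_integral => u _.
rewrite !trunc_powE patchE mem_setE in_itv/= subr_gt0.
by case: ifP => //= _; [case: ifP; rewrite ?mulr0|rewrite mul0r].
Qed.

Lemma Beta_ereal1 p : 0 < p -> Beta_ereal p 1 = (p^-1)%:E.
Proof.
move=> p0; rewrite Beta_ereal_itv -(integral_powR01 p0); apply: eq_integral => u _.
by rewrite subrr powRr0 mulr1.
Qed.

Lemma Gamma_ereal1 : Gamma_ereal 1 = 1%E :> \bar R.
Proof.
rewrite Gamma_ereal_itv -(integral_exponential_pdf (ltr01 : 0 < 1 :> R)).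
transitivity (\int[mu]_(u in `[0%R, +oo[) (exponential_pdf 1 u)%:E)%E.
  rewrite -integral_itv_obnd_cbnd; last first.
    by apply/measurable_EFinP; apply: measurable_funTS; exact: measurable_exponential_pdf.
  apply: eq_integral => u; rewrite inE/= in_itv/= andbT => u0.
  by rewrite exponential_pdfE ?ltW// subrr powRr0 mulr1 mul1r mulN1r.
rewrite [LHS]integral_mkcond; apply: eq_integral => u _.
rewrite patchE mem_setE in_itv/= andbT; case: ifPn => // u0.
by rewrite lt0_exponential_pdf// ltNge.
Qed.

Lemma Gamma_erealD1 p : 0 < p -> (Gamma_ereal (p + 1) = p%:E * Gamma_ereal p)%E.
Proof.
move=> p0; have := Gamma_ereal_Beta_ereal p 1; rewrite Beta_ereal1// Gamma_ereal1 mule1 => ->.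
by rewrite muleA -EFinM mulfV ?gt_eqF// mul1e.
Qed.

(** When [p <= 1] the integrand is at most [u ^ (p - 1)] before 1 and at most
    [e ^ (- u)] after 1; the functional equation reaches the larger arguments. *)
Lemma Gamma_ereal_fin_num p : 0 < p -> Gamma_ereal p \is a fin_num.
Proof.
have base q : 0 < q <= 1 -> Gamma_ereal q \is a fin_num.
  move=> /andP[q0 q1].
  rewrite ge0_fin_numE ?Gamma_ereal_ge0//.
  apply: (@le_lt_trans _ _ (Beta_ereal q 1 + Gamma_ereal 1)%E); last first.
    by rewrite Beta_ereal1// Gamma_ereal1 -EFinD ltry.
  have mB : measurable_fun [set: R] (fun u => (trunc_pow q u * trunc_pow 1 (1 - u))%:E).
    by apply/measurable_EFinP; exact: measurable_trunc_pow_conv.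
  rewrite /Beta_ereal /Gamma_ereal -ge0_integralD//; last 3 first.
  - by move=> u _; rewrite lee_fin mulr_ge0 ?trunc_pow_ge0.
  - by move=> u _; rewrite lee_fin mulr_ge0 ?expR_ge0 ?trunc_pow_ge0.
  - exact: measurable_Gamma_ereal.
  apply: ge0_le_integral => //.
  - by move=> u _; rewrite lee_fin mulr_ge0 ?expR_ge0 ?trunc_pow_ge0.
  - exact: measurable_Gamma_ereal.
  - by apply: emeasurable_funD => //; exact: measurable_Gamma_ereal.
  move=> u _; rewrite -EFinD lee_fin !trunc_powE subr_gt0 subrr !powRr0.
  case: ifPn => u0; last by rewrite mulr0 mul0r addr0.
  have eu := expR_gt0 (- u); have pu := powR_ge0 u (q - 1).
  case: ifPn => [u1|]; rewrite ?mulr1 ?mulr0 ?add0r.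
    have e1 : expR (- u) <= 1 by rewrite -expR0 ler_expR; lra.
    by nra.
  rewrite -leNgt => u1; rewrite ler_piMr ?expR_ge0//.
  by rewrite -[leRHS](powRr0 u) ler_powR//; lra.
have ind n : forall q, 0 < q <= n.+1%:R -> Gamma_ereal q \is a fin_num.
  elim: n => [//|n IHn] q /andP[q0 qn].
  have [q1|q1] := leP q 1; first by rewrite base// q0.
  rewrite -[q](subrK 1) Gamma_erealD1 ?subr_gt0//; apply: fin_numM => //.
  by apply: IHn; rewrite subr_gt0 q1 lerBlDr natr1.
by move=> p0; apply: (ind (Num.trunc p)); rewrite p0 ltW// truncnS_gt.
Qed.

(** Before 1 the integrand is at least [e ^ (- 1) * u ^ (p - 1)]. *)
Lemma Gamma_ereal_gt0 p : 0 < p -> (0 < Gamma_ereal p)%E.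
Proof.
move=> p0; apply: (@lt_le_trans _ _ ((expR (- 1))%:E * Beta_ereal p 1)%E).
  by rewrite Beta_ereal1// -EFinM lte_fin mulr_gt0 ?expR_gt0 ?invr_gt0.
have mB : measurable_fun [set: R] (fun u => (trunc_pow p u * trunc_pow 1 (1 - u))%:E).
  by apply/measurable_EFinP; exact: measurable_trunc_pow_conv.
have B0 u : (0 <= (trunc_pow p u * trunc_pow 1 (1 - u))%:E)%E.
  by rewrite lee_fin mulr_ge0 ?trunc_pow_ge0.
rewrite -ge0_integralZl_EFin ?expR_ge0//.
apply: ge0_le_integral => //.
- by move=> u _; rewrite mule_ge0// lee_fin expR_ge0.
- exact: measurable_funeM.
- exact: measurable_Gamma_ereal.
move=> u _; rewrite -EFinM lee_fin [trunc_pow 1 _]trunc_powE subr_gt0 subrr powRr0.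
case: ifPn => [u1|_]; last by rewrite !mulr0 mulr_ge0 ?expR_ge0 ?trunc_pow_ge0.
by rewrite mulr1 ler_wpM2r ?trunc_pow_ge0// ler_expR; lra.
Qed.

Lemma Gamma_gt0 p : 0 < p -> 0 < Gamma p.
Proof.
move=> p0; rewrite Gamma_fine fine_gt0// Gamma_ereal_gt0//.
by rewrite -ge0_fin_numE ?Gamma_ereal_ge0// Gamma_ereal_fin_num.
Qed.

Lemma GammaD1 p : 0 < p -> Gamma (p + 1) = p * Gamma p.
Proof.
by move=> p0; rewrite !Gamma_fine Gamma_erealD1// fineM ?Gamma_ereal_fin_num//.
Qed.

(** Dividing by [Gamma (p + q)] is legitimate since it is finite and positive;
    this also excludes an infinite Beta integral. *)
Lemma Beta_ereal_Gamma p q : 0 < p -> 0 < q ->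
  Beta_ereal p q = (Gamma p * Gamma q / Gamma (p + q))%:E.
Proof.
move=> p0 q0; have pq0 : 0 < p + q by lra.
have := Gamma_ereal_Beta_ereal p q.
rewrite -[Gamma_ereal p]fineK ?Gamma_ereal_fin_num// -[Gamma_ereal q]fineK ?Gamma_ereal_fin_num//.
rewrite -[Gamma_ereal (p + q)]fineK ?Gamma_ereal_fin_num// -!Gamma_fine.
case: (Beta_ereal p q) (Beta_ereal_ge0 p q) => [r _|_|//].
  by move=> [->]; rewrite mulfK// gt_eqF// Gamma_gt0.
by rewrite gt0_mulye// lte_fin Gamma_gt0.
Qed.

End gamma.

(** * Growth under a bound on the derivative *)

Section unit_interval.
Context {R : realType}.
Implicit Types (h : R -> R) (s t al C D : R).

(** Both [g - h] and [g + h] are nondecreasing. *)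
Lemma norm_sub_le_of_derive1_le (h g dg : R -> R) (t : R) : 0 < t ->
  {within `[0, t], continuous h} -> {within `[0, t], continuous g} ->
  (forall u, u \in `]0, t[%R -> derivable h u 1) ->
  (forall u, u \in `]0, t[%R -> is_derive u 1 g (dg u)) ->
  (forall u, u \in `]0, t[%R -> `|derive1 h u| <= dg u) ->
  `|h t - h 0| <= g t - g 0.
Proof.
move=> t0 ch cg dh dgE hg.
have dgu u : u \in `]0, t[%R -> derivable g u 1 /\ derive1 g u = dg u.
  by move=> /dgE [? ?]; rewrite derive1E.
have i0 : 0 \in `[0, t]%R by rewrite in_itv/= lexx ltW.
have it : t \in `[0, t]%R by rewrite in_itv/= lexx ltW.
have mono (k : R -> R) : {within `[0, t], continuous k} ->
    (forall u, u \in `]0, t[%R -> derivable k u 1) ->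
    (forall u, u \in `]0, t[%R -> 0 <= derive1 k u) -> k 0 <= k t.
  by move=> ck dk k0; apply: (ger0_derive1_le_cc dk k0 ck) => //; exact: ltW.
have := mono (g - h); have := mono (g + h).
rewrite !fctE => H1 H2; rewrite ler_norml; apply/andP; split.
- suff : g 0 + h 0 <= g t + h t by lra.
  apply: H1.
  + by move=> x; apply: continuousD; [exact: cg|exact: ch].
  + by move=> u ut; apply: derivableD; [exact: (dgu u ut).1|exact: dh].
  + move=> u ut; rewrite derive1E deriveD; [|exact: (dgu u ut).1|exact: dh].
    rewrite -!derive1E (dgu u ut).2; have := hg u ut; rewrite ler_norml; lra.
- suff : g 0 - h 0 <= g t - h t by lra.
  apply: H2.
  + by move=> x; apply: continuousB; [exact: cg|exact: ch].
  + by move=> u ut; apply: derivableB; [exact: (dgu u ut).1|exact: dh].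
  + move=> u ut; rewrite derive1E deriveB; [|exact: (dgu u ut).1|exact: dh].
    rewrite -!derive1E (dgu u ut).2; have := hg u ut; rewrite ler_norml; lra.
Qed.

(** The primitive of [D * t ^ s + C * (1 - t) ^ s] that vanishes at 0. *)
Definition growth s C D t : R :=
  (D * t `^ (s + 1) + C * (1 - (1 - t) `^ (s + 1))) / (s + 1).

Lemma growth0 s C D : 0 < s -> growth s C D 0 = 0.
Proof.
move=> s0; rewrite /growth subr0 powR1 subrr powR0 ?mulr0 ?addr0 ?mul0r//.
by rewrite gt_eqF// addr_gt0.
Qed.

Lemma is_derive_powR_onem p t : t < 1 ->
  is_derive t 1 (fun u : R => (1 - u) `^ p) (- (p * (1 - t) `^ (p - 1))).
Proof.
move=> t1; have t1' : 0 < 1 - t by rewrite subr_gt0.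
have dl : is_derive t 1 (fun u : R => 1 - u) (0 - 1) by apply: is_deriveB.
have := @is_derive1_comp R (fun u => u `^ p) (fun u => 1 - u) t _ _ (is_derive1_powR p t1') dl.
by rewrite sub0r mulrN1.
Qed.

Lemma is_derive_growth s C D t : 0 < s -> 0 < t < 1 ->
  is_derive t 1 (growth s C D) (D * t `^ s + C * (1 - t) `^ s).
Proof.
move=> s0 /andP[t0 t1].
have d1 : is_derive t 1 (fun u : R => u `^ (s + 1)) ((s + 1) * t `^ (s + 1 - 1)).
  exact: is_derive1_powR.
have d2 := is_derive_powR_onem (s + 1) t1.
rewrite (_ : growth s C D = (fun u => (s + 1)^-1 *: (D *: u `^ (s + 1) +
    C *: (1 - (1 - u) `^ (s + 1))))); last first.
  by apply/funext => u; rewrite /growth mulrC.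
apply: is_derive_eq.
by rewrite /GRing.scale /= addrK; field; rewrite gt_eqF// addr_gt0.
Qed.

(** Only the end point 0 needs care: there [powR] is continuous from the right
    but not from the left. *)
Lemma within_continuous_growth s C D t : 0 < s -> 0 < t < 1 ->
  {within `[0, t], continuous (growth s C D)}.
Proof.
move=> s0 /andP[t0 t1]; apply/continuous_within_itvP => //.
have cg u : 0 < u < 1 -> {for u, continuous (growth s C D)}.
  move=> u01; apply/differentiable_continuous/derivable1_diffP.
  by have [] := is_derive_growth C D s0 u01.
split.
- by move=> u /[!in_itv]/= /andP[u0 ut]; apply: cg; rewrite u0 (lt_trans ut).
- rewrite growth0//.
  rewrite -[X in _ --> X](mul0r (s + 1)^-1); apply: cvgM; last exact: cvg_cst.
  rewrite -[X in _ --> X]addr0; apply: cvgD.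
    rewrite -[X in _ --> X](mulr0 D); apply: cvgM; first exact: cvg_cst.
    by apply: powR_cvg0; rewrite addr_gt0.
  rewrite -[X in _ --> X](mulr0 C); apply: cvgM; first exact: cvg_cst.
  rewrite -[X in _ --> X](subrr 1); apply: cvgB; first exact: cvg_cst.
  rewrite -[X in _ --> X](_ : (1 - 0) `^ (s + 1) = 1); last by rewrite subr0 powR1.
  apply: cvg_at_right_filter.
  suff : {for 0, continuous (fun u : R => (1 - u) `^ (s + 1))} by [].
  apply/differentiable_continuous/derivable1_diffP.
  by have [] := is_derive_powR_onem (s + 1) (ltr01 : 0 < 1 :> R).
- by apply: cvg_at_left_filter; apply: cg; rewrite t0.
Qed.

(** Only interior values of [t] are integrated below; leaving out [t = 1] avoids
    the continuity of [growth] there. *)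
Lemma norm_sub_le_growth h s C D t : 0 < s -> 0 < t < 1 ->
  {within `[0, 1], continuous h} ->
  (forall u, 0 < u < 1 -> derivable h u 1) ->
  (forall u, 0 < u < 1 -> `|derive1 h u| <= D * u `^ s + C * (1 - u) `^ s) ->
  `|h t - h 0| <= growth s C D t.
Proof.
move=> s0 /andP[t0 t1] ch dh hle; rewrite -[leRHS]subr0 -[X in _ <= _ - X](growth0 C D s0).
have int u : u \in `]0, t[%R -> 0 < u < 1.
  by rewrite in_itv/= => /andP[u0 ut]; rewrite u0 (lt_trans ut).
apply: (@norm_sub_le_of_derive1_le _ _ (fun u => D * u `^ s + C * (1 - u) `^ s) _ t0).
- by apply: continuous_subspaceW ch; apply: subset_itvl; rewrite bnd_simp ltW.
- by apply: within_continuous_growth; rewrite ?t0.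
- by move=> u /int /dh.
- by move=> u /int u01; exact: is_derive_growth.
- by move=> u /int /hle.
Qed.
End unit_interval.

(** * Weighted means on the unit interval *)

Section weighted_mean.
Context {R : realType}.
Local Notation mu := (@lebesgue_measure R).
Implicit Types (h : R -> R) (s t p q al C D : R).

(** Transfers an integral computed in the extended reals to the real-valued
    integral. *)
Lemma ge0_integrable_Rintegral (A : set (measurableTypeR R)) (f : R -> R) (r : R) :
  measurable A -> measurable_fun A f -> (forall t, A t -> 0 <= f t) ->
  (\int[mu]_(t in A) (f t)%:E = r%:E)%E ->
  mu.-integrable A (EFin \o f) /\ \int[mu]_(t in A) f t = r.
Proof.
move=> mA mf f0 fr; split; last by rewrite /Rintegral fr.
apply/integrableP; split; first exact/measurable_EFinP.
rewrite (_ : integral _ _ _ = r%:E) ?ltry// -fr.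
by apply: eq_integral => t; rewrite inE => /f0 ft; rewrite /= ger0_norm.
Qed.

Lemma Rintegral_powR01 p : 0 < p ->
  mu.-integrable `]0, 1[ (EFin \o (fun t : R => t `^ (p - 1))) /\
  \int[mu]_(t in `]0, 1[) t `^ (p - 1) = p^-1.
Proof.
move=> p0; apply: ge0_integrable_Rintegral => //.
- by apply: measurable_funTS; exact: measurable_powR.
- by move=> t _; exact: powR_ge0.
- exact: integral_powR01.
Qed.

Lemma Rintegral_Beta p q : 0 < p -> 0 < q ->
  mu.-integrable `]0, 1[
    (EFin \o (fun t : R => t `^ (p - 1) * (1 - t) `^ (q - 1))) /\
  \int[mu]_(t in `]0, 1[) (t `^ (p - 1) * (1 - t) `^ (q - 1)) =
    Gamma p * Gamma q / Gamma (p + q).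
Proof.
move=> p0 q0; apply: ge0_integrable_Rintegral => //.
- apply: measurable_funTS; apply: measurable_funM; first exact: measurable_powR.
  have m1 : measurable_fun [set: measurableTypeR R] (fun t : R => 1 - t) by exact: measurable_funB.
  exact: (measurableT_comp (measurable_powR (q - 1)) m1).
- by move=> t _; rewrite mulr_ge0 ?powR_ge0.
- by rewrite -Beta_ereal_itv Beta_ereal_Gamma.
Qed.

Lemma integrable_powR01_bounded p h (M : R) : 0 < p ->
  measurable_fun (`]0, 1[%classic : set (measurableTypeR R)) h ->
  (forall t, 0 < t < 1 -> `|h t| <= M) ->
  mu.-integrable `]0, 1[ (EFin \o (fun t => t `^ (p - 1) * h t)).
Proof.
move=> p0 mh hM.
have [ip _] := Rintegral_powR01 p0.
apply: le_integrable (integrableZl _ M ip) => //.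
- apply/measurable_EFinP; apply: measurable_funM => //.
  by apply: measurable_funTS; exact: measurable_powR.
- move=> t; rewrite /= in_itv/= => /hM htM; rewrite lee_fin !normrM mulrC.
  by rewrite ler_wpM2r// (le_trans htM)// ler_norm.
Qed.

Lemma weighted_mean_growth s C D al : 0 < s -> 0 < al ->
  mu.-integrable `]0, 1[
    (EFin \o (fun t : R => t `^ (al - 1) * growth s C D t)) /\
  al * \int[mu]_(t in `]0, 1[) (t `^ (al - 1) * growth s C D t) =
   al / ((s + 1) * (al + s + 1)) * D
   + ((s + 1)^-1 - Gamma (al + 1) * Gamma (s + 1) / Gamma (al + s + 2)) * C.
Proof.
move=> s0 al0.
have mI : measurable (`]0, 1[%classic : set (measurableTypeR R)) by [].
have s1 : 0 < s + 1 by lra.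
have s2 : 0 < s + 1 + 1 by lra.
have as1 : 0 < al + s + 1 by lra.
have [i1 E1] := Rintegral_powR01 as1.
have [i2 E2] := Rintegral_powR01 al0.
have [i3 E3] := Rintegral_Beta al0 s2.
pose g1 t := D / (s + 1) * t `^ (al + s + 1 - 1).
pose g2 t := C / (s + 1) * t `^ (al - 1).
pose g3 t := C / (s + 1) * (t `^ (al - 1) * (1 - t) `^ (s + 1 + 1 - 1)).
have [j1 j2 j3] : [/\ mu.-integrable `]0, 1[ (EFin \o g1),
   mu.-integrable `]0, 1[ (EFin \o g2) & mu.-integrable `]0, 1[ (EFin \o g3)].
  split.
  - exact: (integrableZl mI (D / (s + 1)) i1).
  - exact: (integrableZl mI (C / (s + 1)) i2).
  - exact: (integrableZl mI (C / (s + 1)) i3).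
have j12 : mu.-integrable `]0, 1[ (EFin \o (fun t => g1 t + g2 t)).
  exact: (integrableD mI j1 j2).
have gE t : `]0, 1[%classic t ->
    t `^ (al - 1) * growth s C D t = g1 t + g2 t - g3 t.
  rewrite /= in_itv/= => /andP[t0 t1].
  rewrite /g1 /g2 /g3 /growth !addrK.
  rewrite (_ : al + s = (al - 1) + (s + 1)); last by ring.
  rewrite [t `^ (al - 1 + _)]powRD ?(gt_eqF t0) ?implybT//.
  by field; rewrite gt_eqF.
split.
  apply: (@eq_integrable _ _ _ mu _ mI (EFin \o (fun t => g1 t + g2 t - g3 t))) => //.
    by move=> t; rewrite inE => /gE /= ->.
  exact: (integrableB mI j12 j3).
rewrite (@eq_Rintegral _ _ _ mu _ (fun t => g1 t + g2 t - g3 t)); last first.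
  by move=> t; rewrite inE => /gE.
rewrite RintegralB// RintegralD// /g1 /g2 /g3 !RintegralZl// E1 E2 E3.
rewrite !GammaD1//.
rewrite (_ : al + (s + 1 + 1) = al + s + 2); last by ring.
have G2 := Gamma_gt0 (_ : 0 < al + s + 2); field.
rewrite !gt_eqF ?G2//; lra.
Qed.

(** The weight [al * t ^ (al - 1)] has integral 1, so the left-hand side is the
    norm of the weighted mean of [h 0 - h t], and [growth] bounds the integrand. *)
Lemma weighted_mean_le h s C D al : 0 < s -> 0 < al ->
  {within `[0, 1], continuous h} ->
  (forall u, 0 < u < 1 -> derivable h u 1) ->
  (forall u, 0 < u < 1 -> `|derive1 h u| <= D * u `^ s + C * (1 - u) `^ s) ->
  mu.-integrable `]0, 1[ (EFin \o (fun t : R => t `^ (al - 1) * h t)) /\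
  `|h 0 - al * \int[mu]_(t in `]0, 1[) (t `^ (al - 1) * h t)| <=
   al / ((s + 1) * (al + s + 1)) * D
   + ((s + 1)^-1 - Gamma (al + 1) * Gamma (s + 1) / Gamma (al + s + 2)) * C.
Proof.
move=> s0 al0 ch dh hle.
have mI : measurable (`]0, 1[%classic : set (measurableTypeR R)) by [].
have grow t : 0 < t < 1 -> `|h t - h 0| <= growth s C D t.
  by move=> t01; exact: norm_sub_le_growth.
have mh : measurable_fun (`]0, 1[%classic : set (measurableTypeR R)) h.
  apply: open_continuous_measurable_fun => // t; rewrite inE/= in_itv/= => t01.
  by apply/differentiable_continuous/derivable1_diffP/dh.
have [M hM] : exists M, forall t, 0 < t < 1 -> `|h t| <= M.
  have [c1 _ hc1] := EVT_max ler01 ch; have [c2 _ hc2] := EVT_min ler01 ch.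
  exists (`|h c1| + `|h c2|) => t /andP[t0 t1].
  have t01 : t \in `[0, 1]%R by rewrite in_itv/= !ltW.
  have := hc1 _ t01; have := hc2 _ t01; rewrite ler_norml.
  have := ler_norm (h c1); have := ler_norm (- h c2); rewrite normrN.
  have := normr_ge0 (h c1); have := normr_ge0 (h c2); lra.
have ih := integrable_powR01_bounded al0 mh hM.
split=> //.
have [ig <-] := weighted_mean_growth C D s0 al0.
have [i1 E1] := Rintegral_powR01 al0.
pose k t := t `^ (al - 1) * (h 0 - h t).
have ik0 : mu.-integrable `]0, 1[ (EFin \o (fun t => t `^ (al - 1) * h 0)).
  exact: (integrableZr mI (h 0) i1).
have ik : mu.-integrable `]0, 1[ (EFin \o k).
  rewrite (_ : EFin \o k = EFin \o (fun t => t `^ (al - 1) * h 0 - t `^ (al - 1) * h t)).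
    exact: (integrableB mI ik0 ih).
  by apply/funext => t; rewrite /k /= mulrBr.
have -> : h 0 - al * \int[mu]_(t in `]0, 1[) (t `^ (al - 1) * h t) =
    al * \int[mu]_(t in `]0, 1[) k t.
  rewrite [in RHS](@eq_Rintegral _ _ _ mu _ (fun t => t `^ (al - 1) * h 0 - t `^ (al - 1) * h t)).
    rewrite RintegralB// RintegralZr// E1.
    by field; rewrite gt_eqF.
  by move=> t _; rewrite /k mulrBr.
rewrite normrM gtr0_norm// ler_pM2l//.
apply: (le_trans (le_normr_Rintegral mI ik)).
apply: le_Rintegral => //; first exact: (integrable_norm ik).
move=> t; rewrite /= in_itv/= => t01.
by rewrite /k normrM ger0_norm ?powR_ge0// ler_wpM2l ?powR_ge0// distrC grow.
Qed.
End weighted_mean.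

(** * Functions differentiable relative to an interval *)

Section one_sided.
Context {R : realType}.
Implicit Types (I : set R) (f : R -> R).

(** At an interior point the relative derivative thus is the usual one; this also
    makes the filter proper, which the uniqueness of the limit requires. *)
Lemma within_dnbhs_interior I (y : R) : interior I y -> within I y^' = y^'.
Proof.
move=> Iy; apply/seteqP; split => A NA.
  apply: (@filterS2 _ (nbhs y) _ _ _ (fun z => z != y -> A z) _ Iy NA).
  by move=> z Iz Az zy; exact: Az.
apply: (@filterS _ (nbhs y) _ _ (fun z => z != y -> I z -> A z) _ NA).
by move=> z Az zy _; exact: Az.
Qed.

Lemma derive_in_interior I f y : interior I y -> derivable f y 1 ->
  derive_in I f y = derive1 f y.
Proof.
move=> Iy dfy; rewrite derive1E /derive_in within_dnbhs_interior//.
apply/cvg_lim => //; apply/cvgrPdist_lt => e e0.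
have /cvgrPdist_lt/(_ e e0)[d /= d0 dP] := dfy.
exists d => //= z zd zy; have := dP (z - y).
rewrite /= sub0r normrN -[`|z - y|]normrN opprB => /(_ zd).
rewrite subr_eq0 => /(_ zy); rewrite /GRing.scale/= mulr1 subrK.
exact.
Qed.

(** Near [y] the difference quotient is bounded by [1 + |l|], where [l] is its
    limit. *)
Lemma derivable_in_cvg I f y : derivable_in I f y ->
  f z @[z --> within I (nbhs y)] --> f y.
Proof.
move=> dfy; apply/cvgrPdist_lt => e e0.
set l := derive_in I f y.
have M0 : 0 < 1 + `|l| by rewrite ltr_wpDr.
have Hq : \forall z \near y, z != y -> I z -> `|l - (z - y)^-1 * (f z - f y)| < 1.
  by move/cvgrPdist_lt : dfy => /(_ 1 ltr01).
have Hd : \forall z \near y, `|y - z| < e / (1 + `|l|).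
  by exists (e / (1 + `|l|)) => //=; rewrite divr_gt0.
change (\forall z \near y, I z -> `|f y - f z| < e).
near=> z => Iz.
have [->|zy] := eqVneq z y; first by rewrite subrr normr0.
have qz : `|l - (z - y)^-1 * (f z - f y)| < 1 by move: zy Iz; near: z.
have dz : `|y - z| < e / (1 + `|l|) by near: z.
have zy0 : z - y != 0 by rewrite subr_eq0.
rewrite -[f y - f z]opprB normrN -[f z - f y](mulVKf zy0) normrM -[z - y]opprB normrN.
rewrite ltr_pdivlMr// in dz; apply: le_lt_trans dz; rewrite ler_wpM2l//.
rewrite opprB; set q := _^-1 * _ in qz *.
by have := ler_distD l 0 q; rewrite sub0r normrN sub0r normrN; lra.
Unshelve. all: by end_near. Qed.

End one_sided.

Section segment_mean.
Context {R : realType}.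
Local Notation mu := (@lebesgue_measure R).
Variables (I : set R) (f : R -> R) (a b s : R).
Hypothesis itvI : is_interval I.
Hypothesis df : forall y, interior I y -> derivable f y 1.
Hypotheses (Ia : I a) (Ib : I b) (s_gt0 : 0 < s).
Hypothesis dfI : forall y, a <= y <= b -> derivable_in I f y.
Hypothesis f'cvx :
  s_convex_on s [set y | a <= y <= b] (fun y => `|derive_in I f y|).

Lemma interior_between y : a < y < b -> interior I y.
Proof.
move=> yab; apply: (@filterS _ _ _ `]a, b[%classic).
  move=> z /=; rewrite in_itv/= => /andP[az zb].
  by apply: (itvI Ia Ib); rewrite !ltW.
by apply: open_nbhs_nbhs; split; [exact: interval_open|rewrite /= in_itv].
Qed.

Lemma segment_between (y0 y1 u : R) : a <= y0 <= b -> a <= y1 <= b ->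
  0 <= u <= 1 -> a <= y0 + (y1 - y0) * u <= b.
Proof. by move=> /andP[? ?] /andP[? ?] /andP[? ?]; apply/andP; split; nra. Qed.

Lemma open_segment_between (y0 y1 u : R) : y0 != y1 -> a <= y0 <= b ->
  a <= y1 <= b -> 0 < u < 1 -> a < y0 + (y1 - y0) * u < b.
Proof.
move=> y01 /andP[? ?] /andP[? ?] /andP[? ?].
by have [?|?|/eqP] := ltgtP y0 y1; last (by rewrite (negbTE y01)); apply/andP; split; nra.
Qed.

(** When [y0] or [y1] is an end point of [I], the function [f] need only be
    continuous relative to [I] there. *)
Lemma within_continuous_segment (y0 y1 : R) : a <= y0 <= b -> a <= y1 <= b ->
  {within `[0, 1], continuous (fun u => f (y0 + (y1 - y0) * u))}.
Proof.
move=> y0ab y1ab; rewrite continuous_subspace_in => u.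
rewrite inE/= in_itv/= => u01.
have uab := segment_between y0ab y1ab u01.
rewrite /continuous_at /nbhs /= -nbhs_subspace_in; last by rewrite /= in_itv.
have cf := derivable_in_cvg (dfI uab).
apply: cvg_trans cf => A /= Af.
have c : {for u, continuous (fun u : R => y0 + (y1 - y0) * u)}.
  apply: continuousD; first exact: cst_continuous.
  by apply: continuousM => //; exact: cst_continuous.
have Au : \forall v \near u, I (y0 + (y1 - y0) * v) -> A (f (y0 + (y1 - y0) * v)).
  exact: c _ Af.
change (\forall v \near u, v \in `[0, 1]%R -> A (f (y0 + (y1 - y0) * v))).
near=> v.
rewrite /= in_itv/= => v01.
suff Avv : I (y0 + (y1 - y0) * v) -> A (f (y0 + (y1 - y0) * v)).
  by apply: Avv; exact/(itvI Ia Ib)/segment_between.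
by near: v; exact: Au.
Unshelve. all: by end_near. Qed.

(** Taking [y1 < y0] is allowed: this is how the part of the inequality on the
    right of [x] is obtained. *)
Lemma segment_mean_le (y0 y1 al : R) : 0 < al -> y0 != y1 ->
  a <= y0 <= b -> a <= y1 <= b ->
  mu.-integrable `]0, 1[
    (EFin \o (fun t : R => t `^ (al - 1) * f (y0 + (y1 - y0) * t))) /\
  `|f y0 - al * \int[mu]_(t in `]0, 1[) (t `^ (al - 1) * f (y0 + (y1 - y0) * t))|
   <= `|y1 - y0| * (al / ((s + 1) * (al + s + 1)) * `|derive_in I f y1|
   + ((s + 1)^-1 - Gamma (al + 1) * Gamma (s + 1) / Gamma (al + s + 2))
     * `|derive_in I f y0|).
Proof.
move=> al0 y01 y0ab y1ab.
pose h u := f (y0 + (y1 - y0) * u).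
pose D := `|y1 - y0| * `|derive_in I f y1|.
pose C := `|y1 - y0| * `|derive_in I f y0|.
have intu u : 0 < u < 1 -> interior I (y0 + (y1 - y0) * u).
  by move=> u01; apply: interior_between; exact: open_segment_between.
have dh (u : R) : 0 < u < 1 ->
    is_derive u 1 h (derive1 f (y0 + (y1 - y0) * u) * (y1 - y0)).
  move=> /intu /df dfu.
  apply: (@is_derive1_comp R f (fun u => y0 + (y1 - y0) * u)).
    by rewrite derive1E; exact/derivableP.
  apply: is_derive_eq; rewrite /GRing.scale/=; ring.
have [|||ih hle] := @weighted_mean_le R h s C D al s_gt0 al0.
- exact: within_continuous_segment.
- by move=> u /dh[].
- move=> u u01; have [_] := dh _ u01; rewrite -derive1E => ->.
  rewrite -(derive_in_interior (intu _ u01)) ?normrM; last exact/df/intu.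
  have /andP[u0 u1] := u01.
  have := @f'cvx y0 y1 y0ab y1ab (1 - u) u.
  rewrite (_ : (1 - u) * y0 + u * y1 = y0 + (y1 - y0) * u); last by ring.
  rewrite subrK => /(_ _ _ erefl).
  have k0 := normr_ge0 (y1 - y0).
  rewrite subr_ge0 (ltW u0) (ltW u1) => /(_ isT isT) /(ler_wpM2r k0).
  by move=> /le_trans; apply; rewrite /D /C; lra.
split => //; move: hle; rewrite /h mulr0 addr0 => /le_trans; apply.
by rewrite /D /C; lra.
Qed.
End segment_mean.

(** * Rescaling the Riemann-Liouville kernel *)

Section rescale.
Context {R : realType}.
Local Notation mu := (@lebesgue_measure R).

(** The condition on [A] describes the open segment from [y0] to [y0 + k] for
    either sign of [k]. *)
Lemma Rintegral_kernel_rescale (f : R -> R) (A : set (measurableTypeR R)) (y0 k al : R) :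
  k != 0 -> 0 < al ->
  (forall t, A t <-> 0 < (t - y0) / k < 1) ->
  mu.-integrable `]0, 1[ (EFin \o (fun t : R => t `^ (al - 1) * f (y0 + k * t))) ->
  \int[mu]_(t in A) (`|t - y0| `^ (al - 1) * f t) =
  `|k| `^ al * \int[mu]_(t in `]0, 1[) (t `^ (al - 1) * f (y0 + k * t)).
Proof.
move=> k0 al0 AE ig; have nk0 : 0 < `|k| by rewrite normr_gt0.
have kV0 : k^-1 != 0 by rewrite invr_eq0.
have mI : measurable (`]0, 1[%classic : set (measurableTypeR R)) by [].
(* The factor enters the integral before the change of variable, because
   integrability is known on the unit interval only. *)
pose G t := `|k| `^ (al - 1) * (t `^ (al - 1) * f (y0 + k * t)).
have iG : mu.-integrable `]0, 1[ (EFin \o G) by exact: (integrableZl mI _ ig).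
rewrite -(mulr_powRB1 (ltW nk0) al0) -mulrA -RintegralZl//.
rewrite (@Rintegral_affine R (- y0 / k) k^-1 _ _ kV0 mI iG).
rewrite mulrA normfV mulfV ?gt_eqF// mul1r.
rewrite (_ : [set t | _] = A); last first.
  apply/seteqP; split => t; rewrite AE /= in_itv/=;
    by rewrite (_ : - y0 / k + k^-1 * t = (t - y0) / k)//; ring.
apply: eq_Rintegral => t; rewrite inE => /AE /andP[t0 _].
rewrite /G (_ : - y0 / k + k^-1 * t = (t - y0) / k); last by ring.
rewrite (_ : y0 + k * ((t - y0) / k) = t); last by field.
rewrite mulrA -powRM ?(ltW nk0) ?(ltW t0)//; congr (_ `^ _ * _).
by rewrite -[(t - y0) / k]gtr0_norm// -normrM mulrC divfK.
Qed.

Lemma Gamma_RL_left (f : R -> R) (y d al : R) : y < d -> 0 < al ->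
  mu.-integrable `]0, 1[ (EFin \o (fun t : R => t `^ (al - 1) * f (y + (d - y) * t))) ->
  Gamma (al + 1) * RL_left d al f y = al * ((d - y) `^ al *
    \int[mu]_(t in `]0, 1[) (t `^ (al - 1) * f (y + (d - y) * t))).
Proof.
move=> yd al0 ig; have k0 : 0 < d - y by rewrite subr_gt0.
rewrite /RL_left GammaD1// -mulrA mulVKf ?gt_eqF ?Gamma_gt0//; congr (_ * _).
have AE (t : R) : `]y, d[%classic t <-> 0 < (t - y) / (d - y) < 1.
  by rewrite /= in_itv/= ltr_pdivrMr// mul1r ltrD2r pmulr_lgt0 ?invr_gt0// subr_gt0.
have := Rintegral_kernel_rescale _ al0 AE ig.
rewrite gtr0_norm// => <-; last by rewrite gt_eqF.
apply: eq_Rintegral => t; rewrite inE/= in_itv/= => /andP[yt _].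
by rewrite gtr0_norm// subr_gt0.
Qed.

Lemma Gamma_RL_right (f : R -> R) (c y al : R) : c < y -> 0 < al ->
  mu.-integrable `]0, 1[ (EFin \o (fun t : R => t `^ (al - 1) * f (y + (c - y) * t))) ->
  Gamma (al + 1) * RL_right c al f y = al * ((y - c) `^ al *
    \int[mu]_(t in `]0, 1[) (t `^ (al - 1) * f (y + (c - y) * t))).
Proof.
move=> cy al0 ig; have k0 : c - y < 0 by rewrite subr_lt0.
rewrite /RL_right GammaD1// -mulrA mulVKf ?gt_eqF ?Gamma_gt0//; congr (_ * _).
have AE (t : R) : `]c, y[%classic t <-> 0 < (t - y) / (c - y) < 1.
  rewrite /= in_itv/= nmulr_lgt0 ?invr_lt0// ltr_ndivrMr// mul1r ltrD2r subr_lt0 andbC.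
  by [].
have := Rintegral_kernel_rescale _ al0 AE ig.
rewrite ltr0_norm// opprB => <-; last by rewrite lt_eqF.
apply: eq_Rintegral => t; rewrite inE/= in_itv/= => /andP[_ ty].
by rewrite ltr0_norm ?opprB// subr_lt0.
Qed.
End rescale.

(** * The inequality *)

Theorem theorem7 (R : realType) (I : set R) (f : R -> R) (a b s x alpha : R)
  (itvI : is_interval I)
  (I_ge0 : I `<=` [set y | 0 <= y])
  (df : forall y, interior I y -> derivable f y 1)
  (Ia : I a) (Ib : I b) (ab : a < b)
  (f'L1 : derive_in_L1 I f a b)
  (s_gt0 : 0 < s) (s_le1 : s <= 1)
  (f'cvx : s_convex_on s [set y | a <= y <= b] (fun y => `|derive_in I f y|))
  (ax : a <= x) (xb : x <= b)
  (alpha_gt0 : 0 < alpha) :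
  `| ((x - a) `^ alpha * f a + (b - x) `^ alpha * f b) / (b - a)
     - Gamma (alpha + 1) / (b - a)
       * (RL_left x alpha f a + RL_right x alpha f b) |
  <= alpha / ((s + 1) * (alpha + s + 1))
     * (((x - a) `^ (alpha + 1) + (b - x) `^ (alpha + 1)) / (b - a))
     * `|derive_in I f x|
   + ((s + 1)^-1
      - Gamma (alpha + 1) * Gamma (s + 1) / Gamma (alpha + s + 2))
     * (((x - a) `^ (alpha + 1) * `|derive_in I f a|
         + (b - x) `^ (alpha + 1) * `|derive_in I f b|) / (b - a)).
Proof.
have [dfI _] := f'L1.
have aab : a <= a <= b by rewrite lexx ltW.
have bab : a <= b <= b by rewrite lexx ltW.
have xab : a <= x <= b by rewrite ax.
pose c1 := alpha / ((s + 1) * (alpha + s + 1)).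
pose c2 := (s + 1)^-1 - Gamma (alpha + 1) * Gamma (s + 1) / Gamma (alpha + s + 2).
have half := segment_mean_le itvI df Ia Ib s_gt0 dfI f'cvx alpha_gt0.
have powS (k : R) : 0 <= k -> k `^ (alpha + 1) = k `^ alpha * k.
  move=> k0; rewrite powRD ?powRr1//.
  by rewrite gt_eqF// addr_gt0.
have HL : `|(x - a) `^ alpha * f a - Gamma (alpha + 1) * RL_left x alpha f a| <=
    (x - a) `^ (alpha + 1) * (c1 * `|derive_in I f x| + c2 * `|derive_in I f a|).
  (* When [x = a] both sides vanish, since [0 `^ p = 0] for [p != 0]. *)
  move: (ax); rewrite le_eqVlt => /predU1P[<-|ax'].
    rewrite subrr powR0 ?gt_eqF// !mul0r sub0r normrN /RL_left set_itvoo0 Rintegral_set0.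
    rewrite !mulr0 normr0 powR0 ?mul0r// gt_eqF// addr_gt0//.
  have xa0 : 0 < x - a by rewrite subr_gt0.
  have [ig hle] := half _ _ (negbT (lt_eqF ax')) aab xab.
  rewrite Gamma_RL_left// mulrCA -mulrBr normrM.
  rewrite ger0_norm ?powR_ge0// (powS _ (ltW xa0)) -mulrA ler_wpM2l ?powR_ge0//.
  by apply: (le_trans hle); rewrite gtr0_norm.
have HR : `|(b - x) `^ alpha * f b - Gamma (alpha + 1) * RL_right x alpha f b| <=
    (b - x) `^ (alpha + 1) * (c1 * `|derive_in I f x| + c2 * `|derive_in I f b|).
  (* When [x = b] both sides vanish as well. *)
  move: (xb); rewrite le_eqVlt => /predU1P[->|xb'].
    rewrite subrr powR0 ?gt_eqF// !mul0r sub0r normrN /RL_right set_itvoo0 Rintegral_set0.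
    rewrite !mulr0 normr0 powR0 ?mul0r// gt_eqF// addr_gt0//.
  have bx0 : 0 < b - x by rewrite subr_gt0.
  have [ig hle] := half _ _ (negbT (gt_eqF xb')) bab xab.
  rewrite Gamma_RL_right// mulrCA -mulrBr normrM.
  rewrite ger0_norm ?powR_ge0// (powS _ (ltW bx0)) -mulrA ler_wpM2l ?powR_ge0//.
  by apply: (le_trans hle); rewrite ltr0_norm ?subr_lt0// opprB.
rewrite -/c1 -/c2.
have ba0 : 0 < b - a by rewrite subr_gt0.
set X := `|_|; set Y := (X in _ <= X).
have -> : X = `|((x - a) `^ alpha * f a - Gamma (alpha + 1) * RL_left x alpha f a) +
   ((b - x) `^ alpha * f b - Gamma (alpha + 1) * RL_right x alpha f b)| / (b - a).
  rewrite /X -[in RHS](gtr0_norm ba0) -normf_div; congr `|_|; ring.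
rewrite ler_pdivrMr//; apply: (le_trans (ler_normD _ _)).
apply: (le_trans (lerD HL HR)); rewrite le_eqVlt; apply/orP; left; apply/eqP.
by rewrite /Y; field; rewrite gt_eqF.
Qed.
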